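(* Let $d\geq 2$ be an integer. Let $m^{\ast}:=\frac{d-1}{4}$ if $d$ is prime and $m^{\ast}:=\frac{d-1}{3}$ otherwise. Let $m$ be an integer with $m>m^{\ast}$ and define $$\Omega:=\left(\{-m,\dots,m\}\times\mathbb{Z}_d\right)\cup\left(\mathbb{Z}_d\times\{-m,\dots,m\}\right).$$ If $f,\tilde f\in\mathbb{C}^d$ satisfy $V_{\tilde f}\tilde f\vert_{\Omega}=V_ff\vert_{\Omega}$, then there exists $\gamma\in\mathbb{C}$ with $|\gamma|=1$ satisfying $\tilde f=\gamma f$.
   Context: Let $\mathbb{Z}_d:=\mathbb{Z}/d\mathbb{Z}$. An element $f\in\mathbb{C}^d$ is regarded as a function $\mathbb{Z}_d\to\mathbb{C}$, $j\mapsto f_j$, with all indices interpreted modulo $d$. For integers $k_1<k_2$, $\{k_1,\dots,k_2\}$ denotes the subset $\{[j] : k_1\le j\le k_2\}$ of $\mathbb{Z}_d$, where $[j]$ is the class of $j$ modulo $d$. For $f,g\in\mathbb{C}^d$, the short-time Fourier transform of $f$ with respect to the window $g$ is $V_gf:\mathbb{Z}_d^2\to\mathbb{C}$, $V_gf(k,l):=\sum_{j=0}^{d-1}f_j\overline{g_{j-k}}e^{-2\pi i jl/d}$; in particular $V_ff$ is the ambiguity function of $f$. *)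

(* Defs.v *)
From mathcomp Require Import all_boot all_order all_algebra complex.
From mathcomp Require Import all_classical all_reals all_analysis.

Set Implicit Arguments.
Unset Strict Implicit.
Unset Printing Implicit Defensive.

Import Order.TTheory GRing.Theory Num.Theory.
Local Open Scope classical_set_scope.
Local Open Scope ring_scope.

(* All uses assume 1 < d: 'Z_0 and 'Z_1 both denote Z/2Z. *)

Definition expi (R : realType) (t : R) : R[i] := Complex (cos t) (sin t).

(* In the exponent, j and l stand for their representatives in {0, ..., d-1};
   the value of the exponential does not depend on that choice. *)
Definition stft (R : realType) (d : nat) (g f : 'Z_d -> R[i])
    (p : 'Z_d * 'Z_d) : R[i] :=
  \sum_(j : 'Z_d)
    f j * (g (j - p.1))^* * expi (- (2 * pi * j%:R * p.2%:R / d%:R)).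

Definition Zd_range (d : nat) (k1 k2 : int) : set 'Z_d :=
  [set j%:~R | j in [set j : int | k1 <= j <= k2]].
Arguments Zd_range : clear implicits.

Definition Omega (d : nat) (m : int) : set ('Z_d * 'Z_d) :=
  (Zd_range d (- m) m `*` setT) `|` (setT `*` Zd_range d (- m) m).
Arguments Omega : clear implicits.

Definition mstar (d : nat) : rat :=
  if prime d then (d%:R - 1) / 4 else (d%:R - 1) / 3.

(* Main.v *)
Require Import Defs.
From mathcomp Require Import all_boot all_order all_algebra complex.
From mathcomp Require Import all_classical all_reals all_analysis.
From mathcomp Require Import zify ring lra.

Set Implicit Arguments.
Unset Strict Implicit.
Unset Printing Implicit Defensive.

Import Order.TTheory GRing.Theory Num.Theory.
Local Open Scope classical_set_scope.
Local Open Scope ring_scope.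

(** The two parts of [Omega] are used differently. Write [S] for the support of
    [f], which is also the support of [ft] because the moduli agree.

    - For a shift [k] with [|k| <= m] all frequencies of
      [j |-> f j * (f (j - k))^*] are known, hence by Fourier inversion so are
      these products. Therefore the quotient [ft / f], which has modulus 1 on
      [S], is constant along any chain in [S] of steps of length at most [m].
    - For an arbitrary shift [k], the difference of the products
      [ft j * (ft (j - k))^*] and [f j * (f (j - k))^*] is supported in [S], and
      its Fourier coefficients vanish at the [2m + 1] consecutive frequencies
      [-m, ..., m]. By a Vandermonde argument it vanishes identically as soon
      as [#|S| <= 2m + 1] ([power_sums_eq0], [fourier_strip_eq0]), and then
      [ft] and [f] agree up to a phase.

    It remains to treat [#|S| >= 2m + 2]. If [ft / f] were not constant on [S],
    then [S] would split into two nonempty parts at distance more than [m] from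
    each other; going around the circle there are at least two gaps between
    them, each containing [m] points outside [S] ([card_separated]). Hence
    [#|S| + 2m <= d], which contradicts [d <= 4m + 1]. The last inequality
    follows from [m > (d - 1) / 4], whether or not [d] is prime
    ([stft_determines_up_to_phase]). *)

(** * Vanishing of sparse functions with consecutive zero frequencies *)

(** Invertibility of the Vandermonde matrix on the nodes [x j], [j \in S], in
    the form: distinct nodes cannot satisfy a nontrivial linear relation in all
    powers below [#|S|]. *)
Lemma power_sums_eq0 (F : fieldType) (I : finType) (x : I -> F) (S : {set I})
    (c : I -> F) :
  injective x ->
  (forall i, (i < #|S|)%N -> \sum_(j in S) c j * x j ^+ i = 0) ->
  forall j, j \in S -> c j = 0.
Proof.
move=> x_inj c0 j0 j0S.
(* The polynomial of degree [#|S| - 1] vanishing at all nodes but [x j0]. *)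
pose P : {poly F} := \prod_(j <- enum (S :\ j0)) ('X - (x j)%:P).
have sP : size P = #|S|.
  by rewrite size_prod_XsubC -cardE (cardsD1 j0 S) j0S.
have PE j : P.[x j] = \prod_(k in S :\ j0) (x j - x k).
  rewrite /P big_enum_cond /= horner_prod.
  by apply: eq_big => [k|k _]; rewrite ?andbT ?hornerXsubC.
have : \sum_(j in S) c j * P.[x j] = 0.
  under eq_bigr do rewrite horner_coef mulr_sumr.
  rewrite exchange_big /= big1 // => i _.
  under eq_bigr do rewrite mulrCA.
  by rewrite -mulr_sumr c0 ?mulr0 // -sP.
rewrite (bigD1 j0) //= big1 ?addr0 => [|j /andP[jS jj0]]; last first.
  have jSj0 : j \in S :\ j0 by rewrite finset.in_setD1 jj0.
  by rewrite PE (bigD1 j jSj0) /= subrr mul0r mulr0.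
move=> /eqP; rewrite mulf_eq0 => /orP[/eqP //|].
rewrite PE prodf_seq_eq0 => /hasP[k _ /andP[]].
by rewrite !finset.inE subr_eq0 => /andP[kj0 _] /eqP/x_inj jk; rewrite jk eqxx in kj0.
Qed.

(** A function on Z_d supported in [S], with [#|S|] consecutive vanishing Fourier
    coefficients starting at frequency [l0], is zero. The sum [l0 + i%:R] is
    taken in Z_d, as the frequency argument of [stft] is. *)
Lemma fourier_strip_eq0 (F : fieldType) (d : nat) (z : F) (S : {set 'Z_d})
    (h : 'Z_d -> F) (l0 : 'Z_d) :
  (1 < d)%N -> d.-primitive_root z -> (forall j, j \notin S -> h j = 0) ->
  (forall i, (i < #|S|)%N -> \sum_j h j * (z ^+ j) ^+ ((l0 + i%:R)%R : 'Z_d) = 0) ->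
  forall j, h j = 0.
Proof.
move=> d1 zprim hS h0 j.
have [jS|/hS //] := boolP (j \in S).
have z0 : z != 0 by rewrite (prim_root_eq0 zprim) -lt0n ltnW.
have x_inj : injective (fun j : 'Z_d => z ^+ j).
  have ltd (a : 'Z_d) : (a < d)%N by rewrite -[X in (_ < X)%N](Zp_cast d1).
  move=> a b /eqP; rewrite (eq_prim_root_expr zprim) !modn_small // => /eqP.
  exact: val_inj.
have := @power_sums_eq0 F 'Z_d _ S (fun j => h j * (z ^+ j) ^+ l0) x_inj.
move=> /(_ _ j jS) H.
apply/eqP; have : h j * (z ^+ j) ^+ l0 = 0.
  apply: H => i iS; rewrite -[RHS](h0 i iS).
  have natD : nat_of_ord ((l0 + i%:R)%R : 'Z_d) = ((l0 + i) %% d)%N.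
    by rewrite -val_Zp_nat // natrD natr_Zp.
  rewrite [RHS](bigID (mem S)) [X in _ = _ + X]big1 ?addr0.
    apply: eq_bigr => k _; rewrite -mulrA -exprD -!exprM.
    congr (_ * _); apply/eqP; rewrite (eq_prim_root_expr zprim).
    by rewrite natD modnMmr.
  by move=> k kS; rewrite hS // mul0r.
by move/eqP; rewrite mulf_eq0 !expf_eq0 (negbTE z0) !andbF orbF.
Qed.

(** * Gaps between separated subsets of the cyclic group *)

(** If no point of [B] is reached from [A] by at most [m] positive steps, then
    some point of [A] is followed by [m] points outside both sets. *)
Lemma exists_gap (d m : nat) (A B : {set 'Z_d}) :
  (1 < d)%N -> A != finset.set0 -> B != finset.set0 ->
  (forall a b i, a \in A -> b \in B -> (i <= m)%N -> b != a + i%:R) ->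
  exists2 a, a \in A & forall i, (0 < i <= m)%N -> a + i%:R \notin A :|: B.
Proof.
move=> d1 /set0Pn[a0 a0A] /set0Pn[b0 b0B] sep.
pose P n := [exists a in A, a + n%:R \in B].
have exP : exists n, P n.
  exists (b0 - a0 : 'Z_d); apply/existsP; exists a0.
  by rewrite natr_Zp addrC subrK b0B andbT.
(* A shortest walk from [A] to [B] meets neither set in its interior. *)
case: (ex_minnP exP) => n /existsP[a /andP[aA anB]] nmin.
exists a => // i /andP[i0 im].
have mn : (m < n)%N.
  by rewrite ltnNge; apply/negP => nm; have := sep _ _ _ aA anB nm; rewrite eqxx.
rewrite !finset.inE negb_or; apply/andP; split; apply/negP => iA.
  have /nmin : P (n - i)%N.
    apply/existsP; exists (a + i%:R); rewrite iA /= -addrA -natrD subnKC //; lia.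
  lia.
have /nmin : P i by apply/existsP; exists a; rewrite aA iA.
lia.
Qed.

(** Two nonempty sets at circular distance more than [m] are separated by a gap
    of [m] points on each side. *)
Lemma card_separated (d m : nat) (A B : {set 'Z_d}) :
  (1 < d)%N -> A != finset.set0 -> B != finset.set0 ->
  (forall a b i, a \in A -> b \in B -> (i <= m)%N ->
     (b != a + i%:R) && (a != b + i%:R)) ->
  (#|A :|: B| + m.*2 <= d)%N.
Proof.
move=> d1 A0 B0 sep.
have [a aA ga] : exists2 a, a \in A & forall i, (0 < i <= m)%N ->
    a + i%:R \notin A :|: B.
  by apply: exists_gap => // a b i aA bB im; case/andP: (sep a b i aA bB im).
have [b bB gb] : exists2 b, b \in B & forall i, (0 < i <= m)%N ->
    b + i%:R \notin A :|: B.
  rewrite finset.setUC.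
  by apply: exists_gap => // b a' i bB aA' im; case/andP: (sep a' b i aA' bB im).
have md : (m < d)%N.
  rewrite ltnNge; apply/negP => dm.
  have bam : ((b - a)%R <= m)%N.
    by apply: leq_trans dm; rewrite ltnW // -[X in (_ < X)%N](Zp_cast d1).
  by have := sep a b _ aA bB bam; rewrite natr_Zp subrKC eqxx.
(* The [m] points following [c]. *)
pose G (c : 'Z_d) := [set c + (i.+1)%:R | i : 'I_m]%SET.
have cG c : #|G c| = m.
  rewrite card_imset ?card_ord // => i j /addrI /(congr1 val).
  rewrite /= !val_Zp_nat // !modn_small ?(leq_ltn_trans (ltn_ord _)) //.
  by case=> /val_inj.
have GAB c : (forall i, (0 < i <= m)%N -> c + i%:R \notin A :|: B) ->
    (A :|: B) :&: G c = finset.set0.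
  move=> gc; apply/setP => x; rewrite finset.in_setI finset.in_set0.
  apply/negP => /andP[xAB /imsetP[i _ xE]].
  by have := gc i.+1 (ltn_ord i); rewrite -xE xAB.
have GG : G a :&: G b = finset.set0.
  apply/setP => x; rewrite finset.in_setI finset.in_set0.
  apply/negP => /andP[/imsetP[i _ ->] /imsetP[j _ e]].
  have [ij|/ltnW ji] := leqP i j.
  - have /andP[_ /eqP ab] := sep a b (j - i)%N aA bB
      (leq_trans (leq_subr _ _) (ltnW (ltn_ord j))).
    apply: ab; apply: (addIr (i.+1)%:R); rewrite e -addrA -natrD.
    by congr (_ + _%:R); lia.
  - have /andP[/eqP ba _] := sep a b (i - j)%N aA bB
      (leq_trans (leq_subr _ _) (ltnW (ltn_ord i))).
    apply: ba; apply: (addIr (j.+1)%:R); rewrite -e -addrA -natrD.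
    by congr (_ + _%:R); lia.
have : (#|(A :|: B) :|: (G a :|: G b)| <= d)%N.
  by apply: leq_trans (max_card _) _; rewrite card_ord Zp_cast.
rewrite cardsU finset.setIUr !GAB // finset.setU0 cards0 (cardsU (G a)) GG cards0 !cG.
lia.
Qed.

(** * The discrete Fourier transform *)

Lemma expiD (R : realType) (s t : R) : expi (s + t) = expi s * expi t.
Proof. by rewrite /expi cosD sinD; simpc; congr Complex; rewrite addrC. Qed.

Lemma expi0 (R : realType) : expi (0 : R) = 1.
Proof. by rewrite /expi cos0 sin0. Qed.

Lemma expiMn (R : realType) (t : R) (n : nat) : expi (t *+ n) = expi t ^+ n.
Proof. by elim: n => [|n IHn]; rewrite ?expi0 // mulrS exprS expiD IHn. Qed.

(** The primitive [d]-th root of unity [e^(-2 pi i / d)], with the sign of the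
    exponent in [stft]. *)
Definition dft_root (R : realType) (d : nat) : R[i] := expi (- (2 * pi / d%:R)).

Lemma dft_root_prim (R : realType) (d : nat) :
  (1 < d)%N -> d.-primitive_root (dft_root R d).
Proof.
move=> d1.
have dR : 0 < d%:R :> R by rewrite ltr0n; lia.
have wE n : dft_root R d ^+ n = expi (- ((pi * n%:R / d%:R) *+ 2)).
  by rewrite -expiMn -(mulr_natr _ n); congr expi; ring.
have wd : dft_root R d ^+ d = 1.
  rewrite wE mulfK ?gt_eqF // /expi cosN sinN -[pi *+ 2]add0r cosD2pi sinD2pi.
  by rewrite cos0 sin0 oppr0.
have d0 : (0 < d)%N by lia.
have [k kprim kd] := prim_order_exists d0 wd.
suff kE : k = d by rewrite kE in kprim.
have k0 := prim_order_gt0 kprim.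
apply/eqP; move: (dvdn_leq d0 kd); rewrite leq_eqVlt => /predU1P[->//|kltd].
(* For [0 < k < d] the sine of half the angle is positive, so the cosine of
   the full angle is not 1. *)
have := prim_expr_order kprim; rewrite wE /expi cosN => /(congr1 (@complex.Re R)) /=.
have sin_gt0 : 0 < sin (pi * k%:R / d%:R :> R).
  apply: sin_gt0_pi; rewrite divr_gt0 ?mulr_gt0 ?pi_gt0 ?ltr0n //=.
  by rewrite ltr_pdivrMr // ltr_pM2l ?pi_gt0 // ltr_nat.
rewrite cos_mulr2n; have := cos2Dsin2 (pi * k%:R / d%:R :> R); nra.
Qed.

Lemma stftE (R : realType) (d : nat) (g f : 'Z_d -> R[i]) k l :
  stft g f (k, l) = \sum_j f j * (g (j - k))^* * (dft_root R d ^+ j) ^+ l.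
Proof.
rewrite /stft; apply: eq_bigr => j _; congr (_ * _).
by rewrite -exprM -expiMn; congr expi; rewrite -(mulr_natr _ (j * l)) natrM; ring.
Qed.

(** At a fixed shift [k], ambiguity functions agreeing on [#|S|] consecutive
    frequencies, where [S] contains both supports, come from equal
    products. With [S] the whole group this is Fourier inversion. *)
Lemma autocorrelation_of_strip (R : realType) (d : nat) (f g : 'Z_d -> R[i])
    (S : {set 'Z_d}) (k l0 : 'Z_d) :
  (1 < d)%N -> (forall j, j \notin S -> f j = 0) ->
  (forall j, j \notin S -> g j = 0) ->
  (forall i, (i < #|S|)%N -> stft g g (k, l0 + i%:R) = stft f f (k, l0 + i%:R)) ->
  forall j, g j * (g (j - k))^* = f j * (f (j - k))^*.
Proof.
move=> d1 fS gS fg j; apply/eqP; rewrite -subr_eq0; apply/eqP; move: j.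
apply: (@fourier_strip_eq0 _ d (dft_root R d) S _ l0 d1 (dft_root_prim R d1)) => [j jS|i iS].
  by rewrite fS // gS // !mul0r subr0.
have := fg i iS; rewrite !stftE => /eqP; rewrite -subr_eq0 -sumrB => /eqP fgi.
by rewrite -[RHS]fgi; apply: eq_bigr => j _; rewrite mulrBl.
Qed.

(** * Propagation of the phase *)

(** If [u = gamma * x] and [v * u^* = y * x^*], the phase [gamma] passes from
    the pair [(x, u)] to the pair [(y, v)]. *)
Lemma phase_transfer (R : realType) (x y u v gamma : R[i]) :
  `|gamma| = 1 -> x != 0 -> u = gamma * x -> v * u^* = y * x^* -> v = gamma * y.
Proof.
move=> g1 x0 -> vu.
have gg : gamma * gamma^* = 1 by rewrite -normCK g1 expr1n.
have xc : x^* != 0 by rewrite conjC_eq0.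
apply: (mulIf xc); rewrite -mulrA -vu rmorphM /=.
by rewrite (mulrCA v) (mulrA gamma) gg mul1r.
Qed.

(** The bound [d <= 4m + 1] suffices for every [d]; the four agreement
    hypotheses describe the two strips by natural numbers. *)
Lemma stft_determines_up_to_phase (R : realType) (d m : nat) (f g : 'Z_d -> R[i]) :
  (1 < d)%N -> (d <= (4 * m).+1)%N ->
  (forall i l, (i <= m)%N -> stft g g (i%:R, l) = stft f f (i%:R, l)) ->
  (forall i l, (i <= m)%N -> stft g g (- i%:R, l) = stft f f (- i%:R, l)) ->
  (forall k i, (i <= m)%N -> stft g g (k, i%:R) = stft f f (k, i%:R)) ->
  (forall k i, (i <= m)%N -> stft g g (k, - i%:R) = stft f f (k, - i%:R)) ->
  exists gamma, `|gamma| = 1 /\ forall j, g j = gamma * f j.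
Proof.
move=> d1 dm Vp Vn Wp Wn.
have band k : (forall l, stft g g (k, l) = stft f f (k, l)) ->
    forall j, g j * (g (j - k))^* = f j * (f (j - k))^*.
  move=> Vk; apply: (@autocorrelation_of_strip R d f g [set: 'Z_d]%SET k 0 d1) => [j|j|//];
    by rewrite finset.in_setT.
have norm_eq j : `|g j| = `|f j|.
  have := band 0 (fun l => Vp 0%N l isT) j.
  by rewrite subr0 -!normCK => /eqP; rewrite eqrXn2 // => /eqP.
have g0E j : (g j == 0) = (f j == 0) by rewrite -[LHS]normr_eq0 norm_eq normr_eq0.
have [f0|] := boolP [forall j, f j == 0].
  exists 1; split=> [|j]; first exact: normr1.
  by rewrite (eqP (forallP f0 j)) mulr0; apply/eqP; rewrite g0E (forallP f0).
rewrite negb_forall => /existsP[p fp].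
pose gamma := g p / f p.
have g1 : `|gamma| = 1 by rewrite normrM normfV norm_eq divff ?normr_eq0.
have gp : g p = gamma * f p by rewrite divfK.
exists gamma; split=> //.
pose S := [set j | f j != 0]%SET.
have fS j : j \notin S -> f j = 0 by rewrite finset.inE negbK => /eqP.
have gS j : j \notin S -> g j = 0 by rewrite finset.inE negbK -g0E => /eqP.
(* Small support: the horizontal strip [|l| <= m] has enough frequencies to
   recover the products at every shift. *)
have [Sm|Sm] := leqP #|S| (m.*2.+1).
  have all_eq k j : g j * (g (j - k))^* = f j * (f (j - k))^*.
    apply: (@autocorrelation_of_strip R d f g S k (- m%:R) d1 fS gS) => i iS.
    have [im|mi] := leqP i m.
      by rewrite (_ : _ + _ = - (m - i)%:R) ?Wn ?leq_subr // natrB // opprB addrC.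
    have im : (i <= m.*2)%N := leq_trans iS Sm.
    rewrite addrC -natrB ?(ltnW mi) // Wp //; lia.
  move=> j; apply: (phase_transfer g1 fp gp).
  by have := all_eq (j - p) j; rewrite opprB addrC subrK.
(* Large support: [A] and [B] are the points of [S] where the phase is, or is
   not, [gamma]. *)
pose A := [set j in S | g j == gamma * f j]%SET.
pose B := [set j in S | g j != gamma * f j]%SET.
have B0 : B = finset.set0.
  apply/eqP/negPn/negP => B0.
  have A0 : A != finset.set0 by apply/set0Pn; exists p; rewrite !finset.inE fp gp eqxx.
  have AB : A :|: B = S.
    apply/setP => j; rewrite !finset.inE; by case: (f j == 0); case: (g j == _).
  have : (#|A :|: B| + m.*2 <= d)%N.
    apply: card_separated => // a b i.
    rewrite !finset.inE => /andP[fa /eqP ga] /andP[_ gb] im.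
    apply/andP; split; apply: contraNneq gb => e; apply/eqP.
      apply: (phase_transfer g1 fa ga).
      have := band i%:R (fun l => Vp i l im) b.
      by rewrite (_ : b - i%:R = a) // e addrK.
    apply: (phase_transfer g1 fa ga).
    have := band (- i%:R) (fun l => Vn i l im) b.
    by rewrite opprK -e.
  rewrite AB; lia.
move=> j; apply/eqP/negPn/negP => gj.
have : j \in B.
  rewrite !finset.inE gj andbT; apply: contraNneq gj => fj.
  by rewrite fj mulr0 g0E fj.
by rewrite B0 finset.in_set0.
Qed.

Lemma Zd_range_nat (d m i : nat) : (i <= m)%N ->
  Zd_range d (- m%:Z) m i%:R /\ Zd_range d (- m%:Z) m (- i%:R).
Proof.
move=> im; split; [exists i%:Z => //=; lia|].
exists (- i%:Z); first by rewrite /=; lia.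
by rewrite rmorphN.
Qed.

Theorem corollary3p1 (R : realType) (d : nat) (hd : (2 <= d)%N) (m : int)
    (hm : mstar d < m%:~R) (f ft : 'Z_d -> R[i])
    (hV : {in Omega d m, stft ft ft =1 stft f f}) :
  exists gamma : R[i], `|gamma| = 1 /\ forall j : 'Z_d, ft j = gamma * f j.
Proof.
have d1 : (1 : rat) < d%:R by rewrite ltr1n.
have dm : (d%:R - 1) / 4 < m%:~R :> rat.
  by move: hm; rewrite /mstar; case: ifP => // _; lra.
have m0 : 0 < m by rewrite -(ltr0z rat); lra.
case: m m0 dm hm hV => // m m0 dm _ hV.
(* With [m] a natural number, [4m > d - 1]. *)
have {}dm : (d <= (4 * m).+1)%N.
  rewrite -(ler_nat rat) -addn1 natrD natrM; lra.
have V1 k l : Zd_range d (- m%:Z) m k -> stft ft ft (k, l) = stft f f (k, l).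
  by move=> kr; apply: hV; apply: mem_set; left.
have V2 k l : Zd_range d (- m%:Z) m l -> stft ft ft (k, l) = stft f f (k, l).
  by move=> lr; apply: hV; apply: mem_set; right.
apply: (stft_determines_up_to_phase hd dm) => [i l|i l|k i|k i] im.
- by apply: V1; case: (Zd_range_nat d im).
- by apply: V1; case: (Zd_range_nat d im).
- by apply: V2; case: (Zd_range_nat d im).
- by apply: V2; case: (Zd_range_nat d im).
Qed.
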